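(* Let $G=(V,E)$ be a finite simple graph whose vertex set is partitioned as $V=V_{\mathrm{man}}\cup V_{\mathrm{opt}}$. The convex hull of the incidence vectors $y\in\{0,1\}^E$ of 2MO solutions of $G$ equals the set of $y\in\mathbb{R}^E$ satisfying (i) $\sum_{e\in\delta(i)}y(e)=2$ for all $i\in V_{\mathrm{man}}$; (ii) $\sum_{e\in\delta(i)}y(e)\le 2$ for all $i\in V_{\mathrm{opt}}$; (iii) $\sum_{e\in\delta(S)\setminus F}y(e)+\sum_{e\in F}(1-y(e))\ge 1$ for all $S\subseteq V$ and all $F\subseteq\delta(S)$ such that $F$ is a matching and $|F|$ is odd; (iv) $0\le y(e)\le 1$ for all $e\in E$.
   Context: A 2MO solution (2-matching with optional nodes) of $G$ is a set of edges $M\subseteq E$ such that every vertex in $V_{\mathrm{man}}$ (''mandatory nodes'') is incident to exactly 2 edges of $M$ and every vertex in $V_{\mathrm{opt}}$ (''optional nodes'') is incident to either 0 or 2 edges of $M$. For $S\subseteq V$, $\delta(S)$ denotes the set of edges with exactly one endpoint in $S$, and $\delta(i)=\delta(\{i\})$. *)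

(* Defs.v *)
From HB Require Import structures.
From mathcomp Require Export all_boot all_order all_algebra.
From mathcomp Require Export boolp classical_sets reals.

Set Implicit Arguments.
Unset Strict Implicit.
Unset Printing Implicit Defensive.

Import Order.TTheory GRing.Theory Num.Theory.

(* The edge set as a finite type, so that R^E is {ffun edge E -> R^o}. *)
Notation edge E := {e : {set _} | e \in E}.

Section Graph.

Variable V : finType.

(* A finite simple graph (V, E): edges are two-element sets of vertices. *)
Definition simple_graph (E : {set {set V}}) : Prop :=
  forall e, e \in E -> #|e| = 2.

Variable E : {set {set V}}.

Local Notation edge := (edge E).

Definition cut (S : {set V}) : {set edge} :=
  [set e : edge | #|val e :&: S| == 1].

Definition is_matching (F : {set edge}) : Prop :=
  forall e f, e \in F -> f \in F -> e != f -> [disjoint val e & val f].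

Definition degree_in (M : {set edge}) (i : V) : nat :=
  #|[set e in M | i \in val e]|.

Definition is_2MO (Vman Vopt : {set V}) (M : {set edge}) : Prop :=
  (forall i, i \in Vman -> degree_in M i = 2) /\
  (forall i, i \in Vopt -> degree_in M i = 0 \/ degree_in M i = 2).

Definition incidence_vector (R : realType) (M : {set edge}) :
    {ffun edge -> R^o} :=
  [ffun e => (e \in M)%:R%R].

End Graph.

Local Open Scope ring_scope.

Definition convex_hull (R : numDomainType) (W : lmodType R) (A : set W) :
    set W :=
  fun x => exists (n : nat) (c : 'I_n -> R) (p : 'I_n -> W),
    [/\ forall k, 0 <= c k, \sum_(k < n) c k = 1, forall k, A (p k)
      & x = \sum_(k < n) c k *: p k].

(* Main.v *)
Require Import Defs.
From mathcomp Require Import fintype finset zify ring lra.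

Set Implicit Arguments.
Unset Strict Implicit.
Unset Printing Implicit Defensive.

Import Order.TTheory GRing.Theory Num.Theory.
Local Open Scope ring_scope.

(** The inequalities of type (iii) first extend from matchings [F] to all odd
    [F]. Tutte's gadget then turns 2MO solutions into perfect matchings: each
    vertex gets two copies (joined by an edge, which is used when the vertex is
    left out) and each edge gets one node per endpoint. A point [y] satisfying
    (i)-(iv) becomes a fractional perfect matching of the gadget, and the odd cut
    inequalities there are exactly the blossom inequalities for odd [F].

    The remaining ingredient is Edmonds' perfect matching polytope theorem. By
    induction, a nontrivial tight odd cut is handled by contracting each of its
    sides and gluing the two decompositions along the cut edges; an edge of weight
    1 is deleted with its ends; otherwise some direction keeps all degrees and the
    support, and moving both ways along it makes new constraints tight. *)

(** * Perfect matchings of a multigraph: weights, cuts and mixtures *)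

Section PerfectMatchingPolytope.

Variables (R : realFieldType) (T W : finType).
Implicit Types (s t : T -> W) (x d : T -> R) (A S : {set W}) (M : {set T}).

(** Edges form an abstract type [T] with end maps [s] and [t], so that contracting a vertex set only
    composes the end maps with a retraction. Parallel edges and loops do no harm: a loop lies in no
    cut. *)
Definition delta s t S : {set T} := [set e | (s e \in S) != (t e \in S)].

(** The current graph has vertex set [A] and the edges of nonzero weight, which the second clause
    keeps inside [A]. With [S := A] the last clause forces [#|A|] to be even. *)
Definition fractional_matching s t A x : Prop :=
  [/\ forall e, 0 <= x e,
      forall e, x e != 0 -> [/\ s e != t e, s e \in A & t e \in A],
      forall v, v \in A -> \sum_(e in delta s t [set v]) x e = 1
    & forall S, S \subset A -> odd #|S| -> 1 <= \sum_(e in delta s t S) x e].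

Definition perfect_matching s t A M : Prop :=
  forall v, v \in A -> #|M :&: delta s t [set v]| = 1%N.

(** An arbitrary finite index type lets sums and products of types index new mixtures. *)
Definition matching_mixture s t A x : Prop :=
  exists (I : finType) (c : I -> R) (M : I -> {set T}),
    [/\ forall i, 0 <= c i, \sum_i c i = 1,
        forall i, c i != 0 -> perfect_matching s t A (M i)
      & forall e, x e = \sum_i c i * (e \in M i)%:R].

(** Nonnegative terms cannot cancel. As [perfect_matching] only counts edges at vertices of [A],
    this is what confines the sets [M i] to the support of [x]. *)
Lemma mixture_support x (I : finType) (c : I -> R) (M : I -> {set T}) i e :
  (forall i, 0 <= c i) -> (forall e, x e = \sum_i c i * (e \in M i)%:R) ->
  c i != 0 -> e \in M i -> x e != 0.
Proof.
move=> c0 xE ci ei; rewrite xE (bigD1 i) //= ei mulr1 lt0r_neq0 //.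
by rewrite ltr_wpDr ?sumr_ge0 // => [j _|]; rewrite ?mulr_ge0 // lt0r ci c0.
Qed.

Lemma mixture_convex s t A x1 x2 x (a b : R) :
  0 <= a -> 0 <= b -> a + b = 1 -> (forall e, x e = a * x1 e + b * x2 e) ->
  matching_mixture s t A x1 -> matching_mixture s t A x2 ->
  matching_mixture s t A x.
Proof.
move=> a0 b0 ab xE [I [c [M [c0 c1 cP cE]]]] [J [k [N [k0 k1 kP kE]]]].
exists (I + J)%type,
  (fun ij => match ij with inl i => a * c i | inr j => b * k j end),
  (fun ij => match ij with inl i => M i | inr j => N j end).
split.
- by case=> i; rewrite mulr_ge0.
- by rewrite big_sumType /= -!mulr_sumr c1 k1 !mulr1.
- by case=> i; rewrite mulf_eq0 negb_or => /andP[_]; [apply: cP | apply: kP].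
- move=> e; rewrite xE big_sumType /= cE kE !mulr_sumr.
  by congr (_ + _); apply: eq_bigr => i _; rewrite mulrA.
Qed.

(** * Double counting and linear algebra on the support *)

Lemma in_delta1 s t e w : (e \in delta s t [set w]) = ((s e == w) != (t e == w)).
Proof. by rewrite !inE. Qed.

Lemma card_setI_sum (N D : {set T}) :
  #|N :&: D| = (\sum_(e in N) (e \in D))%N.
Proof.
rewrite -sum1_card big_mkcond [RHS]big_mkcond; apply: eq_bigr => e _.
by rewrite inE; case: (e \in N); case: (e \in D).
Qed.

Lemma handshake s t (N : {set T}) (C : {set W}) :
  (forall e, e \in N -> [/\ s e != t e, s e \in C & t e \in C]) ->
  (\sum_(w in C) #|N :&: delta s t [set w]| = 2 * #|N|)%N.
Proof.
move=> NC; under eq_bigr => w _ do rewrite card_setI_sum.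
rewrite exchange_big -sum1_card big_distrr /=; apply: eq_bigr => e /NC[st sC tC].
have -> : 2%N = #|[set s e; t e]| by rewrite cards2 st.
rewrite muln1 -sum1_card big_mkcond [RHS]big_mkcond; apply: eq_bigr => w _.
rewrite !inE ![w == _]eq_sym; case: (eqVneq (s e) w) => [<-|_].
  by rewrite sC [t e == _]eq_sym (negbTE st).
case: (eqVneq (t e) w) => [<-|_]; first by rewrite tC.
by case: ifP.
Qed.

(** The matrix with rows indexed by [Q] and columns by [A] either has a nonzero left kernel vector,
    which is [d], or has rank [#|Q|]; if it is moreover square, every right-hand side is
    attained. *)
Lemma linear_alternative (Q : {set T}) A (b : T -> W -> R) :
  (exists d : T -> R, [/\ exists2 e, e \in Q & d e != 0,
      forall e, e \notin Q -> d e = 0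
    & forall v, v \in A -> \sum_(e in Q) d e * b e v = 0]) \/
  ((#|Q| <= #|A|)%N /\ (#|Q| = #|A| -> forall r : W -> R, exists d : T -> R,
     forall v, v \in A -> \sum_(e in Q) d e * b e v = r v)).
Proof.
have lift (u : 'rV[R]_#|Q|) : exists2 d : T -> R,
    forall i, d (enum_val i) = u 0 i & forall e, e \notin Q -> d e = 0.
  exists (fun e => \sum_i u 0 i * (enum_val i == e)%:R) => [i|e eQ].
    rewrite (bigD1 i) //= eqxx mulr1 big1 ?addr0 // => j ji.
    by rewrite (inj_eq enum_val_inj) (negbTE ji) mulr0.
  rewrite big1 // => i _; case: eqP => [ie|]; rewrite ?mulr0 //.
  by rewrite -ie enum_valP in eQ.
pose B := \matrix_(i < #|Q|, j < #|A|) b (enum_val i) (enum_val j).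
have mulB (u : 'rV[R]_#|Q|) (d : T -> R) v (vA : v \in A) :
    (forall i, d (enum_val i) = u 0 i) ->
  \sum_(e in Q) d e * b e v = (u *m B) 0 (enum_rank_in vA v).
  move=> dE; rewrite mxE big_enum_val; apply: eq_bigr => i _.
  by rewrite dE mxE enum_rankK_in.
have [freeB|nfree] := boolP (row_free B).
  right; have rkB : \rank B = #|Q| by apply/eqP.
  split=> [|QA r]; first by rewrite -rkB rank_leq_col.
  have fullB : row_full B by rewrite /row_full rkB QA.
  have /submxP[u ru] := submx_full (\row_j r (enum_val j)) fullB.
  have [d dE _] := lift u; exists d => v vA.
  by rewrite (mulB u d v vA dE) -ru mxE enum_rankK_in.
left; rewrite -kermx_eq0 in nfree.
have /rowV0Pn[u /sub_kermxP uB u0] := nfree.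
have [d dE dQ] := lift u; exists d; split=> //.
  have /rV0Pn[i ui] := u0.
  by exists (enum_val i); rewrite ?enum_valP ?dE.
by move=> v vA; rewrite (mulB u d v vA dE) uB mxE.
Qed.

Lemma eq_sum_support x (D1 D2 : {set T}) :
  (forall e, x e != 0 -> (e \in D1) = (e \in D2)) ->
  \sum_(e in D1) x e = \sum_(e in D2) x e.
Proof.
move=> D12; rewrite big_mkcond [RHS]big_mkcond; apply: eq_bigr => e _.
by have [->|/D12->] := eqVneq (x e) 0; first by case: ifP; case: ifP.
Qed.

Lemma le_sum_support x (D1 D2 : {set T}) :
  (forall e, 0 <= x e) -> (forall e, x e != 0 -> e \in D1 -> e \in D2) ->
  \sum_(e in D1) x e <= \sum_(e in D2) x e.
Proof.
move=> x0 D12; rewrite big_mkcond [leRHS]big_mkcond; apply: ler_sum => e _.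
have [->|/D12 h] := eqVneq (x e) 0; first by do 2!case: ifP.
by case: ifP => [/h->|_] //; case: ifP.
Qed.

Lemma support_degree_ge2 s t A x v :
  fractional_matching s t A x -> (forall e, x e < 1) -> v \in A ->
  (2 <= #|[set e | (x e != 0)%R] :&: delta s t [set v]|)%N.
Proof.
move=> [_ _ xv _] x1 /xv xv1; rewrite leqNgt ltnS; apply/negP => le1.
move: xv1; rewrite (@eq_sum_support _ _ ([set e | x e != 0] :&: delta s t [set v])); last first.
  by move=> e xe; rewrite [RHS]inE inE xe.
move: le1; rewrite leq_eqVlt ltnS leqn0 => /orP[/cards1P[e ->]|].
  by rewrite big_set1 => xe; have := x1 e; rewrite xe ltxx.
by rewrite cards_eq0 => /eqP->; rewrite big_set0 => /eqP; rewrite eq_sym oner_eq0.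
Qed.

(* If the incidence system of the support had trivial kernel, the support would
   be 2-regular and the system invertible. The solution [d] for the right-hand
   side concentrated at [v0] alternates in sign along the support away from
   [v0], so the vertices where [d] takes the value [c] or [- c] form an odd set
   whose cut is contained in the star of [v0] minus one edge. *)
Lemma exists_direction s t A x :
  fractional_matching s t A x -> A != set0 -> (forall e, x e < 1) ->
  exists d : T -> R, [/\ exists e, d e != 0, forall e, x e = 0 -> d e = 0
    & forall v, v \in A -> \sum_(e in delta s t [set v]) d e = 0].
Proof.
move=> xfm /set0Pn[v0 v0A] x1; have [x0 xst xv xcut] := xfm.
pose Q := [set e | x e != 0]; pose star v := Q :&: delta s t [set v].
have sumQ d v : \sum_(e in Q) d e * (e \in delta s t [set v])%:R
    = \sum_(e in star v) d e.
  rewrite big_mkcond [RHS]big_mkcond; apply: eq_bigr => e _.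
  by rewrite [e \in star v]inE; case: (e \in Q); case: (e \in delta _ _ _);
     rewrite ?mulr1 ?mulr0.
have [] := linear_alternative Q A (fun e v => (e \in delta s t [set v])%:R : R).
  move=> [d [[e _ de] dQ dv]]; exists d; split; first by exists e.
    by move=> e' xe'; apply: dQ; rewrite inE xe' eqxx.
  move=> v /dv; rewrite sumQ; apply: etrans; apply: eq_sum_support => e' de'.
  rewrite [RHS]inE (_ : e' \in Q) //.
  by apply: contraNT de' => /dQ->.
move=> [leQA solve]; exfalso.
have degQ2 v : v \in A -> (2 <= #|star v|)%N by exact: support_degree_ge2.
have sumdeg : (\sum_(w in A) #|star w| = 2 * #|Q|)%N.
  by apply: handshake => e; rewrite inE => /xst.
(* Degrees at least 2 give [2 * #|A| <= 2 * #|Q|]; with [#|Q| <= #|A|] equality holds, and every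
   vertex of [A] has exactly two support edges. *)
have := leqif_sum (fun i (iA : i \in A) => leqif_eq (degQ2 i iA)).
rewrite sumdeg sum_nat_const => -[ge2 eq2].
have QA : #|Q| = #|A| by lia.
move: eq2; rewrite QA mulnC eqxx => /esym/forall_inP deg2.
have [d dE] := solve QA (fun v => (v == v0)%:R).
have {}dE v : v \in A -> \sum_(e in star v) d e = (v == v0)%:R.
  by move=> vA; rewrite -sumQ dE.
have [e0 e0v0 de0] : exists2 e0, e0 \in star v0 & d e0 != 0.
  apply/exists_inP; apply: contraTT isT => /exists_inPn h.
  have := dE _ v0A; rewrite big1 ?eqxx => [/eqP|e /h/negbNE/eqP //].
  by rewrite eq_sym oner_eq0.
pose c := d e0; pose pm e := (d e == c) || (d e == - c).
pose C := [set w in A | [exists e in star w, pm e]].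
pose N := [set e in Q | d e == - c].
(* The two edges at [w] carry opposite values, so both or neither have value [c] or [- c], and in
   the first case exactly one has [- c]. *)
have starNv0 w e : w \in A -> w != v0 -> e \in star w -> pm e ->
    (forall e', e' \in star w -> pm e') /\ #|N :&: delta s t [set w]| = 1%N.
  move=> wA wv0 ew pe; have /eqP/esym/eqP/cards2P[a [b [ab starw]]] := deg2 _ wA.
  have dab : d a + d b = 0.
    by have := dE _ wA; rewrite (negbTE wv0) starw big_setU1 ?inE //= big_set1.
  have -> : N :&: delta s t [set w] = [set e in star w | d e == - c].
    by apply/setP => f; rewrite !inE -!andbA; congr (_ && _); rewrite andbC.
  have db : d b = - d a by lra.
  have c0 : (c == - c) = false by apply/eqP => ?; case/eqP: de0; rewrite -/c; lra.
  have {ew pe} pa : pm a.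
    move: ew; rewrite starw !inE => /orP[/eqP <- //|/eqP eb]; move: pe.
    by rewrite /pm eb db eqr_oppLR eqr_opp orbC.
  split.
    by move=> f; rewrite starw !inE => /orP[/eqP->|/eqP->] //; rewrite /pm db eqr_oppLR eqr_opp orbC.
  rewrite starw; case/orP: pa => /eqP pa.
    rewrite (_ : [set _ in _ | _] = [set b]) ?cards1 //; apply/setP => f.
    rewrite !inE; case: (eqVneq f b) => [->|fb].
      by rewrite orbT db pa eqxx.
    by rewrite orbF; case: eqP => //= ->; rewrite pa c0.
  rewrite (_ : [set _ in _ | _] = [set a]) ?cards1 //; apply/setP => f.
  rewrite !inE; case: (eqVneq f a) => [->|fa]; first by rewrite pa eqxx.
  by case: eqP => //= ->; rewrite db pa opprK c0.
(* The two values at [v0] sum to 1 and one of them is [c]; a value [- c] would give sum 0 or force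
   [c = 0]. *)
have Nv0 : #|N :&: delta s t [set v0]| = 0%N.
  apply/eqP; rewrite cards_eq0; apply/eqP/setP => e; rewrite in_set0.
  apply/negP; rewrite 2!inE => /andP[/andP[eQ /eqP de] ev0].
  have /eqP/esym/eqP/cards2P[a [b [ab starw]]] := deg2 _ v0A.
  have dab : d a + d b = 1.
    by have := dE _ v0A; rewrite eqxx starw big_setU1 ?inE //= big_set1.
  have : e \in star v0 by rewrite inE eQ.
  have c0 : c <> - c by move=> ?; case/eqP: de0; rewrite -/c; lra.
  move: e0v0; rewrite starw !inE => /orP[]/eqP e0E /orP[]/eqP eE.
  - by apply: c0; rewrite -de eE -e0E.
  - by move: dab; rewrite -e0E -eE de -/c; lra.
  - by move: dab; rewrite -e0E -eE de -/c; lra.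
  - by apply: c0; rewrite -de eE -e0E.
have v0C : v0 \in C.
  by rewrite inE v0A; apply/exists_inP; exists e0; rewrite // /pm eqxx.
have pmC e w : e \in Q -> pm e -> w \in A -> e \in delta s t [set w] -> w \in C.
  move=> eQ pe wA ew; rewrite inE wA; apply/exists_inP; exists e => //.
  by rewrite inE eQ.
have endsQ e : e \in Q -> [/\ s e != t e, s e \in A & t e \in A].
  by rewrite inE => /xst.
have sdelta e : s e != t e -> e \in delta s t [set s e].
  by move=> st; rewrite in_delta1 eqxx [t e == _]eq_sym (negbTE st).
have tdelta e : s e != t e -> e \in delta s t [set t e].
  by move=> st; rewrite in_delta1 eqxx (negbTE st).
(* [N] has one edge at each vertex of [C] except [v0], where it has none, so
   [#|C| - 1 = 2 * #|N|]. *)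
have oddC : odd #|C|.
  have := @handshake s t N C; rewrite (bigD1 v0) //= Nv0 add0n => hs.
  have {}hs : (\sum_(w in C | w != v0) 1 = 2 * #|N|)%N.
    rewrite -hs => [|e]; last first.
      rewrite inE => /andP[eQ de]; have [st sA tA] := endsQ _ eQ.
      by split=> //; apply: (pmC e); rewrite /pm ?de ?orbT ?sdelta ?tdelta.
    apply: eq_bigr => w /andP[]; rewrite inE => /andP[wA /exists_inP[e ew pe]] wv0.
    by have [] := starNv0 w e wA wv0 ew pe.
  by rewrite -sum1_card (bigD1 v0) //= hs oddD /= mul2n odd_double.
have Ccut : 1 <= \sum_(e in delta s t C) x e.
  by apply: xcut => //; apply/subsetP => w; rewrite inE => /andP[].
suff : \sum_(e in delta s t C) x e < 1 by rewrite ltNge Ccut.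
have e0Q : x e0 != 0 by move: e0v0; rewrite !inE => /andP[].
(* A cut edge of [C] carries neither [c] nor [- c], so its end in [C] can only be [v0]; [e0] itself
   does not cross, and its weight is positive. *)
apply: (@le_lt_trans _ _ (\sum_(e in delta s t [set v0] :\ e0) x e)).
  apply: le_sum_support => // e xe eC.
  have eQ : e \in Q by rewrite inE.
  have [st sA tA] := endsQ _ eQ.
  have npm : ~~ pm e.
    apply: contraL eC => pe; rewrite inE negbK.
    by rewrite (pmC e (s e)) ?(pmC e (t e)) ?sdelta ?tdelta.
  have onlyv0 w : w \in C -> e \in delta s t [set w] -> w = v0.
    rewrite inE => /andP[wA /exists_inP[f fw pf]] ew; apply/eqP.
    apply: contraT => wv0; have [h _] := starNv0 w f wA wv0 fw pf.
    by rewrite h // inE eQ in npm.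
  rewrite !in_setD1; apply/andP; split.
    by apply: contraNneq npm => ->; rewrite /pm eqxx.
  move: eC; rewrite inE; case: (boolP (s e \in C)) => [sC _|_].
    by rewrite -(onlyv0 _ sC) sdelta.
  by case: (boolP (t e \in C)) => // tC _; rewrite -(onlyv0 _ tC) tdelta.
have := xv _ v0A; rewrite (big_setD1 e0) /=; last by move: e0v0; rewrite inE => /andP[].
by move=> h; have := x0 e0; rewrite le_eqVlt eq_sym (negbTE e0Q) /=; lra.
Qed.

(** * Moving inside the polytope to a new tight constraint *)

Lemma step_to_boundary (K : finType) (g h : K -> R) :
  (forall k, 0 <= g k) -> (forall k, g k = 0 -> h k = 0) ->
  (exists k, h k < 0) ->
  exists tau, [/\ 0 < tau, forall k, 0 <= g k + tau * h k
    & exists2 k, g k != 0 & g k + tau * h k = 0].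
Proof.
move=> g0 gh [k0 hk0].
(* Ratio test: the first constraint to become tight minimises [g k / - h k] among the decreasing
   ones. *)
case: (arg_minP (P := fun k => h k < 0) (fun k => g k / - h k) hk0) => k hk kmin.
have gk : 0 < g k.
  by rewrite lt0r g0 andbT; apply/eqP => /gh hk'; rewrite hk' ltxx in hk.
exists (g k / - h k); split.
- by rewrite divr_gt0 ?oppr_gt0.
- move=> j; have [hj|hj] := ltP (h j) 0; last first.
    by rewrite addr_ge0 // mulr_ge0 // divr_ge0 ?ltW ?oppr_gt0.
  have := kmin j hj; rewrite [leRHS]/(_ / _) ler_pdivlMr ?oppr_gt0 //.
  by rewrite mulrN -subr_ge0 opprK.
- exists k; first by rewrite lt0r_neq0.
  by rewrite invrN mulrN mulNr divfK ?subrr // ltr0_neq0.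
Qed.

(** Sets that give no odd cut constraint get slack 0, so [active] counts exactly the inequalities
    that are not tight. *)
Definition slack s t A x (k : T + {set W}) : R :=
  match k with
  | inl e => x e
  | inr U => if (U \subset A) && odd #|U| then \sum_(e in delta s t U) x e - 1
             else 0
  end.

Definition active s t A x := #|[set k | slack s t A x k != 0]|.

Lemma in_delta_setD s t A S e : S \subset A -> s e \in A -> t e \in A ->
  (e \in delta s t (A :\: S)) = (e \in delta s t S).
Proof.
by move=> SA sA tA; rewrite !inE sA tA !andbT; case: (s e \in S); case: (t e \in S).
Qed.

Lemma move_to_boundary s t A x d :
  fractional_matching s t A x ->
  (forall S, S \subset A -> odd #|S| -> (1 < #|S|)%N -> (1 < #|A :\: S|)%N ->
     \sum_(e in delta s t S) x e != 1) ->
  (exists e, d e != 0) -> (forall e, x e = 0 -> d e = 0) ->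
  (forall v, v \in A -> \sum_(e in delta s t [set v]) d e = 0) ->
  exists2 tau, 0 < tau & let x' := fun e => x e + tau * d e in
    fractional_matching s t A x' /\ (active s t A x' < active s t A x)%N.
Proof.
move=> [x0 xst xv xcut] ntight [e de] dx dv.
pose h (k : T + {set W}) := match k with
  | inl e => d e
  | inr U => if (U \subset A) && odd #|U| then \sum_(e in delta s t U) d e else 0
  end.
have slackD tau k :
    slack s t A (fun e => x e + tau * d e) k = slack s t A x k + tau * h k.
  case: k => //= S; case: ifP => _; rewrite ?mulr0 ?addr0 //.
  by rewrite big_split /= -mulr_sumr addrAC.
have xd f : d f != 0 -> x f != 0 by apply: contraNneq => /dx->.
have slack0 k : 0 <= slack s t A x k.
  by case: k => //= S; case: ifP => // /andP[SA oS]; rewrite subr_ge0 xcut.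
(* A tight odd cut is the star of a vertex, possibly after complementing in [A], or the cut of [A]
   itself; [d] sums to 0 on each. *)
have slackh k : slack s t A x k = 0 -> h k = 0.
  case: k => /= [|S]; first exact: dx.
  case: ifP => // /andP[SA oS] /eqP; rewrite subr_eq0 => tight.
  have [S1|S1] := leqP #|S| 1.
    have /cards1P[v Sv] : #|S| == 1%N by rewrite eqn_leq S1; case: #|S| oS.
    by rewrite Sv dv // -sub1set -Sv.
  have [D1|D1] := leqP #|A :\: S| 1; last by rewrite (negbTE (ntight S SA oS S1 D1)) in tight.
  have cD (f : T -> R) : (forall e, f e != 0 -> x e != 0) ->
      \sum_(e in delta s t S) f e = \sum_(e in delta s t (A :\: S)) f e.
    move=> fx; apply: eq_sum_support => e' /fx/xst[_ sA tA].
    by rewrite in_delta_setD.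
  rewrite cD //; move: D1; rewrite leq_eqVlt ltnS leqn0 => /orP[/cards1P[v Dv]|].
    by rewrite Dv dv //; have := set11 v; rewrite -Dv inE => /andP[].
  rewrite cards_eq0 => /eqP D0; rewrite D0 big1 // => f.
  by rewrite !inE.
have hneg : exists k, h k < 0.
  have [st sA tA] := xst _ (xd _ de).
  case: (boolP [exists f, d f < 0]) => [/existsP[f df]|/existsPn nd].
    by exists (inl f).
  case/eqP: de; apply: (psumr_eq0P _ (dv _ sA)).
    by move=> f _; rewrite leNgt nd.
  by rewrite in_delta1 eqxx [t e == _]eq_sym (negbTE st).
have [tau [tau0 tau_ge0 [k gk hk]]] := step_to_boundary slack0 slackh hneg.
exists tau => //=; set x' := fun e => _.
have x'E k' : slack s t A x' k' = slack s t A x k' + tau * h k' by exact: slackD.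
split; first split.
- by move=> f'; exact: (tau_ge0 (inl f')).
- move=> f' x'f; apply: xst; apply: contraNneq x'f => xf.
  by rewrite /x' xf dx // mulr0 addr0.
- by move=> v vA; rewrite big_split /= -mulr_sumr dv // xv // mulr0 addr0.
- move=> S SA oS; have := tau_ge0 (inr S).
  by rewrite -x'E /= SA oS subr_ge0.
rewrite /active; apply: proper_card; apply/properP; split.
  apply/subsetP => k'; rewrite !inE; apply: contraNneq => sk.
  by rewrite x'E sk slackh // mulr0 addr0.
by exists k; rewrite !inE // x'E hk eqxx.
Qed.

(** An edge of weight 1 exhausts the degree of both ends, so every other edge there has weight 0 and
    the rest lives on [A']. Adding [e0] to each matching undoes the deletion. *)
Lemma mixture_remove_edge s t A x e0 :
  fractional_matching s t A x -> 1 <= x e0 ->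
  let A' := A :\: [set s e0; t e0] in
  let x' := fun e => if e == e0 then 0 else x e in
  fractional_matching s t A' x' /\
  (matching_mixture s t A' x' -> matching_mixture s t A x).
Proof.
move=> [x0 xst xv xcut] x1 A' x'.
have [st sA tA] : [/\ s e0 != t e0, s e0 \in A & t e0 \in A].
  by apply: xst; rewrite lt0r_neq0 // (lt_le_trans ltr01).
have e0s : e0 \in delta s t [set s e0].
  by rewrite in_delta1 eqxx [t e0 == _]eq_sym (negbTE st).
have e0t : e0 \in delta s t [set t e0] by rewrite in_delta1 eqxx (negbTE st).
have x'0 e : 0 <= x' e by rewrite /x'; case: ifP.
have star_e0 v e : v \in A -> e0 \in delta s t [set v] -> x' e != 0 ->
    e \notin delta s t [set v].
  move=> vA e0v; rewrite /x'; case: (eqVneq e e0) => [_|ee0 xe]; first by rewrite eqxx.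
  apply/negP => ev; have := xv _ vA; rewrite (bigD1 e0) //= (bigD1 e) /=; last by rewrite ev.
  have : 0 < x e by rewrite lt0r xe x0.
  set y := \sum_(i | _) _; have : 0 <= y by apply: sumr_ge0.
  by lra.
have x'x e : x' e != 0 -> x e != 0 by rewrite /x'; case: ifP; rewrite ?eqxx.
have x'st e : x' e != 0 -> [/\ s e != t e, s e \in A' & t e \in A'].
  move=> x'e; have [ste seA teA] := xst _ (x'x _ x'e).
  have := star_e0 _ _ sA e0s x'e; have := star_e0 _ _ tA e0t x'e.
  rewrite !in_delta1 !negbK => /eqP et /eqP es.
  split=> //; rewrite !inE ?seA ?teA andbT negb_or.
    apply/andP; split; apply/negP => h.
      by move: es; rewrite h => /esym/eqP tes; case/eqP: ste; rewrite tes; apply/eqP.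
    by move: et; rewrite h => /esym/eqP tes; case/eqP: ste; rewrite tes; apply/eqP.
  apply/andP; split; apply/negP => h.
    by move: es; rewrite h => /eqP tes; case/eqP: ste; rewrite tes; apply/esym/eqP.
  by move: et; rewrite h => /eqP tes; case/eqP: ste; rewrite tes; apply/esym/eqP.
have e0N S : S \subset A' -> e0 \notin delta s t S.
  move=> /subsetP SA'; rewrite inE negbK.
  have /negbTE-> : s e0 \notin S by apply/negP => /SA'; rewrite !inE eqxx.
  by have /negbTE-> : t e0 \notin S by apply/negP => /SA'; rewrite !inE eqxx orbT.
have x'sum S : S \subset A' -> \sum_(e in delta s t S) x' e = \sum_(e in delta s t S) x e.
  move=> SA'; apply: eq_bigr => e eS; rewrite /x'; case: eqP => // ee0.
  by have := e0N S SA'; rewrite -ee0 eS.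
have A'A : A' \subset A by exact: subsetDl.
split.
  split=> //.
  - by move=> v vA'; rewrite x'sum ?sub1set // xv // (subsetP A'A).
  - by move=> S SA' oS; rewrite x'sum // xcut // (subset_trans SA').
move=> [I [c [M [c0 c1 cP cE]]]].
have xe0 : x e0 = 1.
  apply/le_anti; rewrite x1 andbT -(xv _ sA) (bigD1 e0) //= lerDl.
  by apply: sumr_ge0.
exists I, c, (fun i => e0 |: M i); split=> //.
  move=> i ci v vA; have [e0v|e0v] := boolP (e0 \in delta s t [set v]).
    rewrite (_ : _ :&: _ = [set e0]) ?cards1 //; apply/setP => e.
    rewrite in_setI in_setU1 in_set1; case: eqVneq => [->//|ee0] /=.
    apply/negbTE/negP => /andP[eM]; apply/negP; apply: star_e0 => //.
    exact: (mixture_support c0 cE ci eM).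
  have vA' : v \in A'.
    rewrite !inE vA andbT; apply/negP => /orP[]/eqP ve; move: e0v; rewrite ve.
      by rewrite e0s.
    by rewrite e0t.
  rewrite -(cP i ci v vA'); congr #|pred_of_set _|; apply/setP => e.
  by rewrite !in_setI in_setU1; case: eqVneq => [->|] //=; rewrite (negbTE e0v) andbF.
move=> e; have [->|ee0] := eqVneq e e0.
  by rewrite xe0 -[LHS]c1; apply: eq_bigr => i _; rewrite setU11 mulr1.
have := cE e; rewrite /x' (negbTE ee0) => ->.
by apply: eq_bigr => i _; rewrite in_setU1 (negbTE ee0).
Qed.

(** * Coupling and gluing across a tight odd cut *)

(** A joint distribution of pairs of matchings: the cut edge [f] is drawn with probability [x f],
    then [M i] and [N j] independently among those containing [f]. If [x f = 0], the quotient is 0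
    by convention, as it should be. *)
Definition coupling_weight x (D : {set T}) (I J : Type) (c : I -> R) (M : I -> {set T})
    (k : J -> R) (N : J -> {set T}) i j : R :=
  \sum_(f in D) c i * (f \in M i)%:R * (k j * (f \in N j)%:R) / x f.

Lemma coupling_weight_row x (D : {set T}) (I J : finType)
    (c : I -> R) (M : I -> {set T}) (k : J -> R) (N : J -> {set T}) i :
  (forall i, 0 <= c i) -> (c i != 0 -> #|M i :&: D| = 1%N) ->
  (forall f, f \in D -> x f = \sum_i c i * (f \in M i)%:R) ->
  (forall f, f \in D -> x f = \sum_j k j * (f \in N j)%:R) ->
  \sum_j coupling_weight x D c M k N i j = c i.
Proof.
move=> c0 cD xc xk; rewrite /coupling_weight exchange_big /=.
have [ci0|ci] := eqVneq (c i) 0.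
  by rewrite big1 // => f _; rewrite big1 // => j _; rewrite ci0 !mul0r.
transitivity (\sum_(f in D) c i * (f \in M i)%:R); last first.
  by rewrite -mulr_sumr -natr_sum -card_setI_sum setIC cD // mulr1.
apply: eq_bigr => f fD; rewrite -mulr_suml -mulr_sumr -xk //.
case: (boolP (f \in M i)) => fM; last by rewrite mulr0 !mul0r.
rewrite mulfK // xc // (bigD1 i) //= fM mulr1 lt0r_neq0 //.
by rewrite ltr_wpDr ?sumr_ge0 // => [l _|]; rewrite ?mulr_ge0 // lt0r ci c0.
Qed.

Lemma coupling x (D : {set T}) (I J : finType)
    (c : I -> R) (M : I -> {set T}) (k : J -> R) (N : J -> {set T}) :
  (forall i, 0 <= c i) -> (forall j, 0 <= k j) ->
  (forall i, c i != 0 -> #|M i :&: D| = 1%N) ->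
  (forall j, k j != 0 -> #|N j :&: D| = 1%N) ->
  (forall f, f \in D -> x f = \sum_i c i * (f \in M i)%:R) ->
  (forall f, f \in D -> x f = \sum_j k j * (f \in N j)%:R) ->
  exists w : I -> J -> R, [/\ forall i j, 0 <= w i j,
    forall i, \sum_j w i j = c i, forall j, \sum_i w i j = k j
  & forall i j, w i j != 0 -> [/\ c i != 0, k j != 0
      & forall f, f \in D -> (f \in M i) = (f \in N j)]].
Proof.
move=> c0 k0 cD kD xc xk; exists (coupling_weight x D c M k N); split.
- move=> i j; apply: sumr_ge0 => f fD; rewrite divr_ge0 ?mulr_ge0 //.
  by rewrite xc // sumr_ge0 // => l _; rewrite mulr_ge0.
- by move=> i; exact: coupling_weight_row c0 (cD i) xc xk.
- move=> j; rewrite -[RHS](coupling_weight_row k0 (kD j) xk xc).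
  by apply: eq_bigr => i _; apply: eq_bigr => f _; congr (_ / _); rewrite mulrC.
move=> i j wij.
(* A nonzero weight yields an edge [f] of [D] in both sets; each meets [D] in a single edge, so both
   traces on [D] are [[set f]]. *)
have [f fD] : exists2 f, f \in D & c i * (f \in M i)%:R * (k j * (f \in N j)%:R) != 0.
  apply/exists_inP; apply: contraNT wij => /exists_inPn h; apply/eqP.
  by apply: big1 => f /h/negbNE/eqP->; rewrite mul0r.
rewrite !mulf_eq0 !negb_or => /andP[/andP[ci fM] /andP[kj fN]]; split=> //.
have {}fM : f \in M i by move: fM; case: (f \in M i); rewrite ?eqxx.
have {}fN : f \in N j by move: fN; case: (f \in N j); rewrite ?eqxx.
have one (L : {set T}) : #|L :&: D| = 1%N -> f \in L -> forall g, g \in D -> (g \in L) = (g == f).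
  move=> /eqP/cards1P[f' LD] fL g gD; have : f \in L :&: D by rewrite inE fL.
  rewrite LD inE => /eqP ->; have : (g \in L :&: D) = (g == f') by rewrite LD inE.
  by rewrite inE gD andbT.
by move=> g gD; rewrite (one _ (cD i ci)) // (one _ (kD j kj)).
Qed.

Definition touches s t S e := (s e \in S) || (t e \in S).

(** Perfect matchings of the graph with the complement of [S] contracted to one vertex, in terms of
    the original ends: covering the new vertex means having exactly one edge in the cut. *)
Definition half_mixture s t S x : Prop :=
  exists (I : finType) (c : I -> R) (M : I -> {set T}),
    [/\ forall i, 0 <= c i, \sum_i c i = 1,
        forall i, c i != 0 ->
          perfect_matching s t S (M i) /\ #|M i :&: delta s t S| = 1%N
      & forall e, (if touches s t S e then x e else 0)
                  = \sum_i c i * (e \in M i)%:R].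

(** Coupled matchings of the two sides agree on the cut, so their union looks like [M i] at vertices
    of [S] and like [N j] at vertices of [A :\: S]. *)
Lemma glue_mixtures s t A S x :
  fractional_matching s t A x -> S \subset A ->
  half_mixture s t S x -> half_mixture s t (A :\: S) x ->
  matching_mixture s t A x.
Proof.
move=> [x0 xst xv xcut] SA [I [c [M [c0 c1 cP cE]]]] [J [k [N [k0 k1 kP kE]]]].
set D := delta s t S.
have suppM i e : c i != 0 -> e \in M i -> touches s t S e /\ x e != 0.
  by move=> ci ei; have := mixture_support c0 cE ci ei; case: ifP; rewrite ?eqxx.
have suppN j e : k j != 0 -> e \in N j -> touches s t (A :\: S) e /\ x e != 0.
  by move=> ci ei; have := mixture_support k0 kE ci ei; case: ifP; rewrite ?eqxx.
have touchD e : x e != 0 -> (e \in D) = touches s t S e && touches s t (A :\: S) e.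
  move=> /xst[_ sA tA]; rewrite /touches !inE sA tA !andbT.
  by case: (s e \in S); case: (t e \in S).
have ND j : k j != 0 -> #|N j :&: D| = 1%N.
  move=> kj; have [_ <-] := kP j kj; congr #|pred_of_set _|; apply/setP => e.
  rewrite !in_setI; case: (boolP (e \in N j)) => // eN.
  have [_ /xst[_ sA tA]] := suppN _ _ kj eN.
  by rewrite in_delta_setD.
have xM f : f \in D -> x f = \sum_i c i * (f \in M i)%:R.
  move=> fD; have := cE f; rewrite ifT //; move: fD; rewrite /touches !inE.
  by case: (s f \in S); case: (t f \in S).
have xN f : f \in D -> x f = \sum_j k j * (f \in N j)%:R.
  move=> fD; have := kE f; have [xf|xf] := eqVneq (x f) 0; first by rewrite xf if_same.
  by rewrite ifT //; move: fD; rewrite touchD // => /andP[].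
have [w [w0 wc wk wP]] := coupling c0 k0 (fun i ci => (cP i ci).2) ND xM xN.
have inS i j e : w i j != 0 -> touches s t S e -> (e \in M i :|: N j) = (e \in M i).
  move=> /wP[ci kj MN] eS; rewrite in_setU; case: (boolP (e \in N j)) => eN; last by rewrite orbF.
  have [eA xe] := suppN _ _ kj eN; have eD : e \in D by rewrite touchD // eS.
  by rewrite MN // eN.
have inA i j e : w i j != 0 -> touches s t (A :\: S) e -> (e \in M i :|: N j) = (e \in N j).
  move=> /wP[ci kj MN] eS; rewrite in_setU; case: (boolP (e \in M i)) => //= eM.
  have [eA xe] := suppM _ _ ci eM; have eD : e \in D by rewrite touchD // eS eA.
  by rewrite -MN // eM.
have touch1 v (U : {set W}) e : v \in U -> e \in delta s t [set v] -> touches s t U e.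
  move=> vU; rewrite in_delta1 /touches; case: (eqVneq (s e) v) => [->|_]; first by rewrite vU.
  by case: (eqVneq (t e) v) => [->|_] //; rewrite vU orbT.
exists (I * J)%type, (fun ij => w ij.1 ij.2), (fun ij => M ij.1 :|: N ij.2); split.
- by move=> ij.
- rewrite -(pair_bigA _ (fun i j => w i j)) /= -c1.
  by apply: eq_bigr => i _; rewrite wc.
- move=> [i j] /= wij v vA; have [ci kj _] := wP _ _ wij.
  have [vS|vS] := boolP (v \in S).
    rewrite -((cP i ci).1 v vS); congr #|pred_of_set _|; apply/setP => e.
    rewrite !in_setI; case: (boolP (e \in delta s t [set v])) => [ev|_]; last by rewrite !andbF.
    by rewrite (inS i j e wij (touch1 _ _ _ vS ev)).
  have vAS : v \in A :\: S by rewrite inE vS.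
  rewrite -((kP j kj).1 v vAS); congr #|pred_of_set _|; apply/setP => e.
  rewrite !in_setI; case: (boolP (e \in delta s t [set v])) => [ev|_]; last by rewrite !andbF.
  by rewrite (inA i j e wij (touch1 _ _ _ vAS ev)).
- move=> e; rewrite -(pair_bigA _ (fun i j => w i j * (e \in M i :|: N j)%:R)) /=.
  have [eS|eS] := boolP (touches s t S e).
    have := cE e; rewrite eS => ->; apply: eq_bigr => i _.
    rewrite -wc mulr_suml; apply: eq_bigr => j _.
    by have [->|/inS->] := eqVneq (w i j) 0; rewrite ?mul0r.
  have -> : x e = if touches s t (A :\: S) e then x e else 0.
    have [->|xe] := eqVneq (x e) 0; first by rewrite if_same.
    rewrite ifT //; have [_ sA tA] := xst _ xe; move: eS.
    by rewrite /touches negb_or !inE sA tA => /andP[-> ->].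
  rewrite exchange_big kE; apply: eq_bigr => j _.
  rewrite -wk mulr_suml; apply: eq_bigr => i _.
  have [->|wij] := eqVneq (w i j) 0; rewrite ?mul0r // in_setU.
  case: (boolP (e \in M i)) => //= eM; have [ci _ _] := wP _ _ wij.
  by have [] := suppM _ _ ci eM; rewrite (negbTE eS).
Qed.

(* The vertices outside [S] are merged into [a]; edges inside the merged part
   get weight [0]. *)
Lemma contract_mixture s t A S a x :
  fractional_matching s t A x -> S \subset A -> a \in A :\: S ->
  odd #|A :\: S| -> \sum_(e in delta s t S) x e = 1 ->
  (forall s' t' x', fractional_matching s' t' (a |: S) x' ->
     matching_mixture s' t' (a |: S) x') ->
  half_mixture s t S x.
Proof.
move=> [x0 xst xv xcut] SA; rewrite inE => /andP[aS aA] oAS tight IH.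
pose g v := if v \in S then v else a.
pose x' e := if touches s t S e then x e else 0.
have x'x e : x' e != 0 -> touches s t S e /\ x e != 0.
  by rewrite /x'; case: ifP; rewrite ?eqxx.
have gS v u : u \in S -> (g v == u) = (v == u).
  rewrite /g; case: ifP => // vS uS.
  by apply/eqP/eqP => h; [rewrite h uS in aS | rewrite h uS in vS].
have gid v : v \in S -> g v = v by rewrite /g => ->.
have ga v : (g v == a) = (v \notin S).
  by rewrite /g; case: ifP => vS; rewrite ?eqxx //; apply: contraNF aS => /eqP <-.
pose up (U : {set W}) := [set v in A | g v \in U].
have cutE (U : {set W}) : \sum_(e in delta (g \o s) (g \o t) U) x' e
    = \sum_(e in delta s t (up U)) x e.
  rewrite big_mkcond [RHS]big_mkcond; apply: eq_bigr => e _; rewrite /x' !inE /=.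
  have [->|xe] := eqVneq (x e) 0; first by rewrite !if_same.
  have [st -> ->] := xst _ xe; rewrite /=.
  case: (boolP (touches s t S e)) => //; rewrite /touches negb_or => /andP[sS tS].
  by rewrite /g (negbTE sS) (negbTE tS) eqxx.
have upS v : v \in S -> up [set v] = [set v].
  move=> vS; apply/setP => u; rewrite !inE gS //.
  by case: eqP => [->|]; rewrite ?andbF // (subsetP SA).
have upa : up [set a] = A :\: S.
  by apply/setP => u; rewrite !inE ga andbC.
have fm' : fractional_matching (g \o s) (g \o t) (a |: S) x'.
  have gA v : g v \in a |: S by rewrite !inE /g; case: (boolP (v \in S)) => [->|_]; rewrite ?eqxx ?orbT.
  split.
  - by move=> e; rewrite /x'; case: ifP.
  - move=> e /x'x[eS /xst[st _ _]]; split=> //=.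
    move: eS; rewrite /touches; case: (boolP (s e \in S)) => [sS _|sS /= tS].
      by rewrite (gid (s e)) // eq_sym gS // eq_sym.
    by rewrite (gid (t e)) // gS.
  - move=> v; rewrite cutE in_setU1 => /orP[/eqP->|vS]; last by rewrite upS // xv // (subsetP SA).
    rewrite upa -tight; apply: eq_sum_support => e /xst[_ sA tA].
    by rewrite in_delta_setD.
  (* [up U] trades [a], if present, for the whole of [A :\: S]; this set is odd, so parity
     survives. *)
  - move=> U UA oU; rewrite cutE xcut //; first by apply/subsetP => v; rewrite inE => /andP[].
    rewrite -(cardsID S); have -> : up U :&: S = U :\ a.
      apply/setP => v; rewrite !inE /g; case: (boolP (v \in S)) => [vS|vS]; last first.
        rewrite andbF; case: eqVneq => //= va; apply/esym/negP => /(subsetP UA).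
        by rewrite !inE (negbTE va) (negbTE vS).
      rewrite (subsetP SA) // andbT; case: eqVneq => // va.
      by rewrite -va vS in aS.
    have [aU|aU] := boolP (a \in U).
      have -> : up U :\: S = A :\: S.
        apply/setP => v; rewrite !inE /g; case: (boolP (v \in S)) => //= vS.
        by rewrite aU andbT.
      by move: oU; rewrite (cardsD1 a U) aU !oddD oAS /= addbT.
    have -> : up U :\: S = set0.
      apply/setP => v; rewrite !inE /g; case: (boolP (v \in S)) => //= vS.
      by rewrite (negbTE aU) andbF.
    by move: oU; rewrite (cardsD1 a U) (negbTE aU) cards0 addn0.
have [I [c [M [c0 c1 cP cE]]]] := IH _ _ _ fm'.
have suppM i e : c i != 0 -> e \in M i -> touches s t S e.
  by move=> ci ei; have [] := x'x _ (mixture_support c0 cE ci ei).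
exists I, c, M; split=> // i ci; split.
  move=> v vS; rewrite -(cP i ci v) ?in_setU1 ?vS ?orbT //.
  by congr #|pred_of_set _|; apply/setP => e; rewrite !inE /= !gS.
rewrite -(cP i ci a) ?setU11 //; congr #|pred_of_set _|; apply/setP => e.
by rewrite !inE /= !ga; case: (s e \in S); case: (t e \in S).
Qed.

(** Edmonds' theorem, by induction on [#|A|] and, for fixed [A], on the number of constraints that
    are not tight. *)
Theorem fractional_matching_mixture s t A x :
  fractional_matching s t A x -> matching_mixture s t A x.
Proof.
have [n] := ubnP #|A|; elim: n => // n IHn in s t A x *.
rewrite ltnS => leAn.
have {}IHn s' t' A' x' : (#|A'| < #|A|)%N -> fractional_matching s' t' A' x' ->
    matching_mixture s' t' A' x'.
  by move=> A'A; apply: IHn; apply: leq_trans leAn.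
have [m] := ubnP (active s t A x); elim: m => // m IHm in x *.
rewrite ltnS => leAm xfm; have [x0 xst xv xcut] := xfm.
have [A0|A0] := eqVneq A set0.
  have xz e : x e = 0.
    by apply/eqP; apply: contraT => /xst[_]; rewrite A0 inE.
  exists unit, (fun=> 1), (fun=> set0); split=> //.
  - by rewrite big_const card_unit /= addr0.
  - by move=> i _ v; rewrite A0 inE.
  - by move=> e; rewrite xz big1 // => i _; rewrite inE mulr0.
have [/existsP[e xe]|/existsPn x1] := boolP [exists e, 1 <= x e].
  have [fm' mix] := mixture_remove_edge xfm xe; apply/mix/IHn => //.
  have [_ sA _] : [/\ s e != t e, s e \in A & t e \in A].
    by apply: xst; rewrite lt0r_neq0 // (lt_le_trans ltr01).
  apply: proper_card; apply/properP; split; first exact: subsetDl.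
  by exists (s e); rewrite // !inE eqxx.
have evenA : ~~ odd #|A|.
  apply/negP => /(xcut A (subxx A)); rewrite big1 ?ler10 // => e; rewrite inE => eA.
  by apply/eqP; apply: contraTT eA => /xst[_ -> ->].
(* At least two vertices on each side ensure that contracting either side leaves fewer vertices than
   [A] has. *)
have [/existsP[S /and5P[SA oS S1 D1 /eqP tight]]|/existsPn nt] := boolP [exists S : {set W},
    [&& S \subset A, odd #|S|, (1 < #|S|)%N, (1 < #|A :\: S|)%N
      & \sum_(e in delta s t S) x e == 1]].
  have cS := cardsDS SA; have leS := subset_leq_card SA.
  have oD : odd #|A :\: S| by rewrite cS oddB // oS (negbTE evenA).
  have DD : A :\: (A :\: S) = S by rewrite setDDr setDv set0U; apply/setIidPr.
  have /card_gt0P[a aD] : (0 < #|A :\: S|)%N by apply: ltnW.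
  have /card_gt0P[b bS] : (0 < #|S|)%N by apply: ltnW.
  apply: (glue_mixtures xfm SA).
    apply: (contract_mixture xfm SA aD oD tight) => s' t' x'; apply: IHn.
    move: aD; rewrite inE => /andP[aS _]; rewrite cardsU1 aS; lia.
  apply: (@contract_mixture _ _ _ _ b _ xfm (subsetDl _ _)); rewrite ?DD //.
    rewrite -tight; apply: eq_sum_support => e /xst[_ sA tA].
    by rewrite in_delta_setD.
  move=> s' t' x'; apply: IHn; rewrite cardsU1 !inE bS /=; lia.
have [|d [dn dx dv]] := exists_direction xfm A0; first by move=> e; rewrite ltNge x1.
have ntight S : S \subset A -> odd #|S| -> (1 < #|S|)%N -> (1 < #|A :\: S|)%N ->
    \sum_(e in delta s t S) x e != 1.
  by move=> SA oS S1 D1; have := nt S; rewrite SA oS S1 D1.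
have [a a0 [fma aa]] := move_to_boundary xfm ntight dn dx dv.
have [||| b b0 [fmb ab]] := @move_to_boundary s t A x (fun e => - d e) xfm ntight.
- by case: dn => e de; exists e; rewrite oppr_eq0.
- by move=> e /dx->; rewrite oppr0.
- by move=> v /dv dv0; rewrite sumrN dv0 oppr0.
have ab0 : a + b != 0 by rewrite lt0r_neq0 // addr_gt0.
(* With these coefficients the displacements [a * d e] and [- (b * d e)] cancel. *)
apply: (mixture_convex (a := b / (a + b)) (b := a / (a + b)) _ _ _ _
  (IHm _ (leq_trans aa leAm) fma) (IHm _ (leq_trans ab leAm) fmb)).
- by rewrite divr_ge0 ?ltW ?addr_gt0.
- by rewrite divr_ge0 ?ltW ?addr_gt0.
- by rewrite -mulrDl addrC divff.
- by move=> e /=; field.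
Qed.

End PerfectMatchingPolytope.

Lemma big_prod (T : Type) (idx : T) (op : Monoid.com_law idx) (I J : finType)
    (f : I * J -> T) :
  \big[op/idx]_z f z = \big[op/idx]_i \big[op/idx]_j f (i, j).
Proof. by rewrite pair_bigA; apply: eq_bigr => -[]. Qed.

(** * Blossom inequalities and Tutte's gadget *)

Section OptionalTwoMatching.

Variables (R : realFieldType) (X V : finType) (p q : X -> V).
Hypothesis pq : forall e, p e != q e.
Implicit Types (y : X -> R) (S : {set V}) (F M : {set X}).

Local Notation cut := (delta p q).
Local Notation star i := (delta p q [set i]).

(** In the degree sum over [S], an edge with both ends in [S] counts twice and a cut edge once. *)
Lemma odd_card_cut M S :
  odd #|M :&: cut S| = odd (\sum_(w in S) #|M :&: star w|).
Proof.
under eq_bigr => w _ do rewrite card_setI_sum.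
rewrite exchange_big card_setI_sum /=.
elim/big_rec2: _ => // e m n _; rewrite !oddD => ->; congr (_ (+) _).
transitivity (odd ((p e \in S) + (q e \in S))).
  by rewrite inE; case: (p e \in S); case: (q e \in S).
congr odd; rewrite !(big_mkcond (mem S)) /=.
rewrite (bigD1 (p e)) //= (bigD1 (q e)) /= ?[_ == p e]eq_sym ?pq //.
rewrite !in_delta1 !eqxx [q e == p e]eq_sym (negbTE (pq e)) /=.
rewrite big1 ?addn0 => [|w /andP[wp wq]].
  by case: (p e \in S); case: (q e \in S).
by rewrite in_delta1 ![_ == w]eq_sym (negbTE wp) (negbTE wq) eqxx if_same.
Qed.

Definition blossom_cost y S F : R :=
  \sum_(e in cut S :\: F) y e + \sum_(e in F) (1 - y e).

Lemma blossom_costE y S F : F \subset cut S ->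
  blossom_cost y S F =
  \sum_e (if e \in F then 1 - y e else if e \in cut S then y e else 0).
Proof.
move=> /subsetP FS; rewrite /blossom_cost big_mkcond [X in _ + X]big_mkcond -big_split.
apply: eq_bigr => e _ /=; rewrite in_setD.
by case: (boolP (e \in F)) => [eF|eF] /=; rewrite ?add0r ?addr0.
Qed.

(* If an odd [F] has [k >= 2] edges at [i], then either [k] is even and moving
   [i] across the cut while dropping these edges from [F] does not increase the
   cost, or [k >= 3] and the edges at [i] alone contribute [k - 2 >= 1]. *)
Lemma blossom_cost_ge1 y :
  (forall i, \sum_(e in star i) y e <= 2) -> (forall e, 0 <= y e <= 1) ->
  (forall S F, F \subset cut S -> (forall i, #|F :&: star i| <= 1)%N ->
     odd #|F| -> 1 <= blossom_cost y S F) ->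
  forall S F, F \subset cut S -> odd #|F| -> 1 <= blossom_cost y S F.
Proof.
move=> y2 y01 ymat S F; have [n] := ubnP #|F|; elim: n => // n IHn in S F *.
rewrite ltnS => leFn FS oF.
have [/existsP[i Ki]|/existsPn nK] := boolP [exists i, (1 < #|F :&: star i|)%N]; last first.
  by apply: ymat => // i; rewrite leqNgt nK.
set K := F :&: star i in Ki.
have sumK : \sum_e ((e \in K)%:R - (if e \in star i then y e else 0))
    = #|K|%:R - \sum_(e in star i) y e.
  by rewrite sumrB -natr_sum; congr (_%:R - _); rewrite -big_mkcond ?sum1_card.
have yi := y2 i; rewrite blossom_costE //.
have [oK|eK] := boolP (odd #|K|).
  have K3 : (3 <= #|K|)%N by move: oK Ki; case: #|K| => [|[|[]]].
  have : 3 <= #|K|%:R :> R by rewrite ler_nat.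
  move=> K3R; apply: (@le_trans _ _ (#|K|%:R - \sum_(e in star i) y e)); first lra.
  rewrite -sumK; apply: ler_sum => e _; have /andP[ye0 ye1] := y01 e.
  rewrite in_setI; case: (e \in F); case: (e \in star i) => /=; rewrite ?subr0; try lra.
    by case: ifP => _; lra.
  by case: ifP => _; lra.
pose S' := [set v | (v \in S) (+) (v == i)]; pose F' := F :\: star i.
have cutS' e : (e \in cut S') = (e \in cut S) (+) (e \in star i).
  rewrite !inE; case: (p e \in S); case: (q e \in S); case: (p e == i); by case: (q e == i).
have F'S' : F' \subset cut S'.
  apply/subsetP => e; rewrite inE cutS' => /andP[/negbTE-> /(subsetP FS)->] //.
have cF : #|F| = (#|K| + #|F'|)%N by rewrite cardsID.
have : 1 <= blossom_cost y S' F'.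
  apply: IHn => //; first lia.
  by move: oF; rewrite cF oddD (negbTE eK).
rewrite blossom_costE // => h; apply: le_trans h _.
have : 2 <= #|K|%:R :> R by rewrite ler_nat.
move=> K2; rewrite -[leRHS]subr0.
apply: (@le_trans _ _ (\sum_e (if e \in F then 1 - y e else if e \in cut S then y e else 0)
   - (#|K|%:R - \sum_(e in star i) y e))); last lra.
rewrite -sumK -sumrB; apply: ler_sum => e _; have /andP[ye0 ye1] := y01 e.
rewrite cutS' in_setI in_setD; have := subsetP FS e.
case: (e \in F) => [/(_ isT)->|_]; case: (e \in star i) => /=; rewrite ?subr0; try lra.
  by case: (e \in cut S) => /=; lra.
by case: (e \in cut S) => /=; lra.
Qed.

(* Gadget: a vertex [v] is split into the copies [inl (v, c)], an edge [e] gets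
   one node [inr (e, b)] for each endpoint. Leaving out [e] means matching its
   two nodes with each other; leaving out [v] means matching its two copies. *)
Local Notation GV := (V * bool + X * bool)%type.
Local Notation GE := ((X + X * bool * bool) + V)%type.

Definition endpoint e (b : bool) := if b then q e else p e.

Definition gadget_src (z : GE) : GV :=
  match z with
  | inl (inl e) => inr (e, false)
  | inl (inr (e, b, c)) => inr (e, b)
  | inr v => inl (v, false)
  end.

Definition gadget_tgt (z : GE) : GV :=
  match z with
  | inl (inl e) => inr (e, true)
  | inl (inr (e, b, c)) => inl (endpoint e b, c)
  | inr v => inl (v, true)
  end.

Local Notation gdelta := (delta gadget_src gadget_tgt).

Lemma sum_gadget_cut (x : GE -> R) (U : {set GV}) :
  \sum_(z in gdelta U) x z =
  \sum_e ((((inr (e, false) : GV) \in U) != (inr (e, true) \in U))%:R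
            * x (inl (inl e)) +
     \sum_b \sum_c (((inr (e, b) : GV) \in U) != (inl (endpoint e b, c) \in U))%:R
            * x (inl (inr (e, b, c)))) +
  \sum_v (((inl (v, false) : GV) \in U) != (inl (v, true) \in U))%:R * x (inr v).
Proof.
transitivity (\sum_z (z \in gdelta U)%:R * x z).
  by rewrite big_mkcond; apply: eq_bigr => z _; case: (z \in _); rewrite ?mul1r ?mul0r.
rewrite !big_sumType /= big_split /=; congr (_ + _ + _).
- by apply: eq_bigr => e _; rewrite inE.
- by rewrite big_prod big_prod; do 3![apply: eq_bigr => ? _]; rewrite inE.
- by apply: eq_bigr => e _; rewrite inE.
Qed.

Lemma sum_star_endpoint (x : X -> R) i :
  \sum_(e in star i) x e = \sum_e \sum_b (endpoint e b == i)%:R * x e.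
Proof.
rewrite big_mkcond; apply: eq_bigr => e _; rewrite big_bool /= in_delta1.
have := pq e; case: (eqVneq (p e) i) => [-> iq|_ _].
  by rewrite [q e == i]eq_sym (negbTE iq) mul0r mul1r add0r.
by case: (eqVneq (q e) i); rewrite /= ?mul1r ?mul0r addr0.
Qed.

Lemma sum_star_vertex_copy (x : GE -> R) i c :
  \sum_(z in gdelta [set (inl (i, c) : GV)]) x z =
  \sum_e \sum_b (endpoint e b == i)%:R * x (inl (inr (e, b, c))) + x (inr i).
Proof.
rewrite sum_gadget_cut; congr (_ + _).
  apply: eq_bigr => e _; rewrite !inE /= mul0r add0r.
  apply: eq_bigr => b _; rewrite big_bool /= !inE.
  rewrite !(inj_eq inl_inj) !xpair_eqE.
  by case: (_ == i); case: c; rewrite /= ?mul0r ?addr0 ?add0r.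
rewrite (bigD1 i) //= big1 ?addr0 => [|v vi]; rewrite !inE !(inj_eq inl_inj) !xpair_eqE.
  by rewrite eqxx; case: c; rewrite mul1r.
by rewrite (negbTE vi) mul0r.
Qed.

Lemma sum_star_edge_node (x : GE -> R) e b :
  \sum_(z in gdelta [set (inr (e, b) : GV)]) x z =
  x (inl (inl e)) + \sum_c x (inl (inr (e, b, c))).
Proof.
rewrite sum_gadget_cut [X in _ + X]big1 ?addr0 => [|v _]; last by rewrite !inE mul0r.
rewrite (bigD1 e) //= [X in _ + X]big1 ?addr0 => [|f fe]; last first.
  rewrite !inE !(inj_eq inr_inj) !xpair_eqE (negbTE fe) mul0r add0r big1 // => ? _.
  by rewrite big1 // => ? _; rewrite !inE !(inj_eq inr_inj) !xpair_eqE (negbTE fe) mul0r.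
rewrite !big_bool /= !inE !(inj_eq inr_inj) !xpair_eqE eqxx /=.
by case: b; rewrite /= !mul0r !mul1r ?addr0 ?add0r.
Qed.

(** Each node of [e] splits the weight [y e] evenly between the two copies of its end; the two other
    kinds of edge get what is missing to 1. *)
Definition gadget_weight y (z : GE) : R :=
  match z with
  | inl (inl e) => 1 - y e
  | inl (inr (e, b, c)) => y e / 2
  | inr v => 1 - (\sum_(e in star v) y e) / 2
  end.

Lemma gadget_fractional_matching y :
  (forall i, \sum_(e in star i) y e <= 2) -> (forall e, 0 <= y e <= 1) ->
  (forall S F, F \subset cut S -> odd #|F| -> 1 <= blossom_cost y S F) ->
  fractional_matching gadget_src gadget_tgt [set: GV] (gadget_weight y).
Proof.
move=> y2 y01 yF; split.
- move=> [[e|[[e b] c]]|v] /=; try (have /andP[] := y01 e; lra).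
  by have := y2 v; lra.
- by move=> [[e|[[e b] c]]|v] _; rewrite !inE; split=> //; apply/eqP => -[].
- move=> [[i c]|[e b]] _.
    rewrite sum_star_vertex_copy /= sum_star_endpoint.
    under eq_bigr => e _ do under eq_bigr => b _ do rewrite mulrA.
    under eq_bigr => e _ do rewrite -mulr_suml.
    by rewrite -mulr_suml; lra.
  by rewrite sum_star_edge_node big_bool /=; lra.
move=> U _ oU; rewrite sum_gadget_cut /=.
set al := fun v c => (inl (v, c) : GV) \in U; set be := fun e b => (inr (e, b) : GV) \in U.
pose cost e : R := (be e false != be e true)%:R * (1 - y e) +
  \sum_b \sum_c (be e b != al (endpoint e b) c)%:R * (y e / 2).
pose vcost v : R := (al v false != al v true)%:R * (1 - (\sum_(e in star v) y e) / 2).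
change (1 <= \sum_e cost e + \sum_v vcost v).
have cost0 e : 0 <= cost e.
  have /andP[ye0 ye1] := y01 e; rewrite addr_ge0 ?mulr_ge0 ?subr_ge0 //.
  by do 2!apply: sumr_ge0 => ? _; rewrite mulr_ge0 ?divr_ge0.
have vcost0 v : 0 <= vcost v.
  by rewrite mulr_ge0 //; have := y2 v; lra.
(* If the copies of [i] are separated, the edge joining them pays
   [1 - (\sum_(e in star i) y e) / 2], and each edge [e] at [i] pays [y e / 2], since its node at
   [i] is separated from one of the copies. *)
have [/existsP[i hi]|/existsPn hn] := boolP [exists i, al i false != al i true].
  have : 1 - (\sum_(e in star i) y e) / 2 <= \sum_v vcost v.
    rewrite (bigD1 i) //= {1}/vcost hi mul1r lerDl sumr_ge0 //.
  have : (\sum_(e in star i) y e) / 2 <= \sum_e cost e; last lra.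
  rewrite big_mkcond mulr_suml; apply: ler_sum => e _.
  case: ifP => [|_]; last by rewrite mul0r.
  have /andP[ye0 ye1] := y01 e; move: hi; rewrite in_delta1 /cost !big_bool /=.
  have bool0 (b : bool) : 0 <= b%:R * (y e / 2) by rewrite mulr_ge0 ?divr_ge0.
  move=> hi; case: (eqVneq (p e) i) => [->|_]; last first.
    case: (eqVneq (q e) i) => [->|//] _; move: hi.
    have := bool0 (be e false != al (p e) true); have := bool0 (be e false != al (p e) false).
    have : 0 <= (be e false != be e true)%:R * (1 - y e) by rewrite mulr_ge0 ?subr_ge0.
    by case: (be e true); case: (al i false); case: (al i true) => //= *; lra.
  move=> _; move: hi.
  have := bool0 (be e true != al (q e) true); have := bool0 (be e true != al (q e) false).
  have : 0 <= (be e false != be e true)%:R * (1 - y e) by rewrite mulr_ge0 ?subr_ge0.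
  by case: (be e false); case: (al i false); case: (al i true) => //= *; lra.
have vsum0 : 0 <= \sum_v vcost v by apply: sumr_ge0.
pose a v := al v true.
have aE v c : al v c = a v by case: c => //; have := hn v; rewrite negbK => /eqP.
have costE e : cost e = (be e false != be e true)%:R * (1 - y e)
    + (be e false != a (p e))%:R * y e + (be e true != a (q e))%:R * y e.
  by rewrite /cost !big_bool /= !aE; field.
(* Copies now agree, so an edge whose nodes are separated from each other, and one of them from its
   end, pays at least [(1 - y e) + y e]. *)
have [/existsP[e /andP[be01 bea]]|/existsPn hn2] := boolP [exists e,
    (be e false != be e true) && ((be e false != a (p e)) || (be e true != a (q e)))].
  apply: (@le_trans _ _ (cost e)).
    rewrite costE be01; have /andP[ye0 ye1] := y01 e.
    by case/orP: bea => ->; case: (_ != _); rewrite /=; lra.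
  by rewrite (bigD1 e) //= -addrA lerDl addr_ge0 // sumr_ge0.
(* From here on, separated nodes lie on the same sides as their ends, whence [F \subset cut S]. A
   pair of copies adds an even number to [#|U|], and the nodes of [e] add an odd number exactly when
   [e] is in [F]. *)
pose S := [set v | a v]; pose F := [set e | be e false != be e true].
have cutS e : (e \in cut S) = (a (p e) != a (q e)) by rewrite !inE.
have FS : F \subset cut S.
  apply/subsetP => e; rewrite cutS inE => eF; have := hn2 e.
  by rewrite eF /= negb_or !negbK => /andP[/eqP <- /eqP <-].
have oF : odd #|F|.
  move: oU; rewrite -sum1_card big_mkcond big_sumType /=.
  rewrite !big_prod /=.
  rewrite oddD (_ : odd (\sum_v _) = false) /=.
    rewrite -sum1_card [in X in _ -> X]big_mkcond /=.
    apply: eq_ind; elim/big_rec2: _ => // e m n _; rewrite !oddD => ->; congr (_ (+) _).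
    rewrite big_bool inE -/(be e true) -/(be e false).
    by case: (be e true); case: (be e false).
  elim/big_rec: _ => // v n _; rewrite oddD => -> /=.
  by rewrite big_bool -/(al v true) -/(al v false) !aE addbF oddD addbb.
have := yF S F FS oF; rewrite blossom_costE // => h.
apply: (le_trans h); apply: (@le_trans _ _ (\sum_e cost e)); last by rewrite lerDl.
apply: ler_sum => e _; rewrite costE cutS inE; have := hn2 e; have /andP[ye0 ye1] := y01 e.
by case: (be e false); case: (be e true); case: (a (p e)); case: (a (q e)) => //= _; lra.
Qed.

(** Each copy of [i] is matched to its twin or to one node of a used edge, and a used edge sends
    each of its nodes to exactly one copy. Adding the equations of the two copies gives 0 or 2. *)
Lemma gadget_matching_degree (M : {set GE}) i :
  perfect_matching gadget_src gadget_tgt [set: GV] M ->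
  #|[set e | (inl (inl e) : GE) \notin M] :&: star i| = (2 * ((inr i : GE) \notin M))%N.
Proof.
move=> PM; pose x (z : GE) : R := (z \in M)%:R.
have cardR (D : {set GE}) : \sum_(z in D) x z = #|M :&: D|%:R.
  by rewrite -natr_sum -card_setI_sum setIC.
have vx c : \sum_e \sum_b (endpoint e b == i)%:R * x (inl (inr (e, b, c))) = 1 - x (inr i).
  by have := sum_star_vertex_copy x i c; rewrite cardR PM ?inE // => h;
     apply: (addIr (x (inr i))); rewrite -h subrK.
have ex e b : \sum_c x (inl (inr (e, b, c))) = 1 - x (inl (inl e)).
  by have := sum_star_edge_node x e b; rewrite cardR PM ?inE // => h;
     apply: (addrI (x (inl (inl e)))); rewrite -h addrC subrK.
apply/eqP; rewrite -(eqr_nat R); apply/eqP.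
rewrite setIC card_setI_sum natr_sum sum_star_endpoint.
transitivity (\sum_e \sum_b \sum_c (endpoint e b == i)%:R * x (inl (inr (e, b, c)))).
  apply: eq_bigr => e _; apply: eq_bigr => b _; rewrite -mulr_sumr ex inE /x.
  by case: (_ \in M); rewrite ?subrr ?subr0.
under eq_bigr => e _ do rewrite exchange_big.
rewrite exchange_big /= big_bool !vx /x.
by case: (_ \in M); rewrite /= ?subrr ?subr0 ?addr0.
Qed.

(** If the star of [i] has weight 2, the edge joining the copies of [i] has weight 0 and occurs in
    no matching of positive weight; this is how mandatory vertices are enforced. *)
Theorem optional_two_matching_mixture y :
  (forall i, \sum_(e in star i) y e <= 2) -> (forall e, 0 <= y e <= 1) ->
  (forall S F, F \subset cut S -> (forall i, #|F :&: star i| <= 1)%N ->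
     odd #|F| -> 1 <= blossom_cost y S F) ->
  exists (I : finType) (c : I -> R) (M : I -> {set X}),
    [/\ forall k, 0 <= c k, \sum_k c k = 1,
        forall k, c k != 0 -> forall i, #|M k :&: star i| = 2%N \/
          \sum_(e in star i) y e != 2 /\ #|M k :&: star i| = 0%N
      & forall e, y e = \sum_k c k * (e \in M k)%:R].
Proof.
move=> y2 y01 ymat.
have fm := gadget_fractional_matching y2 y01 (blossom_cost_ge1 y2 y01 ymat).
have [I [c [M [c0 c1 cP cE]]]] := fractional_matching_mixture fm.
exists I, c, (fun k => [set e | (inl (inl e) : GE) \notin M k]); split=> //.
  move=> k ck i; rewrite gadget_matching_degree; last exact: cP.
  case: (boolP (inr i \in M k)) => iM; [right | by left].
  split=> //; apply: contraNneq (mixture_support c0 cE ck iM) => /= ->.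
  by rewrite divff ?subrr ?pnatr_eq0.
move=> e; have /= := cE (inl (inl e)); set w := \sum_i _ => yw.
have -> : y e = \sum_k c k - w by lra.
rewrite /w -sumrB; apply: eq_bigr => k _; rewrite inE.
by case: (_ \in M k); rewrite /= ?mulr1 ?mulr0 ?subrr ?subr0.
Qed.

End OptionalTwoMatching.

(** * From two-element edge sets to end maps *)

Section SimpleGraph.

Variables (V : finType) (E : {set {set V}}) (p q : edge E -> V).
Hypothesis pq : forall e, p e != q e.
Hypothesis edgeE : forall e, val e = [set p e; q e].

Lemma cut_delta (S : {set V}) : cut E S = delta p q S.
Proof.
apply/setP => e; rewrite !inE edgeE.
rewrite card_setI_sum big_setU1 ?inE ?pq //= big_set1.
by case: (p e \in S); case: (q e \in S).
Qed.

Lemma in_star e i : (e \in delta p q [set i]) = (i \in val e).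
Proof.
rewrite in_delta1 edgeE !inE ![i == _]eq_sym.
have := pq e; case: (eqVneq (p e) i) => [-> iq|_ _]; last by case: (q e == i).
by rewrite [q e == i]eq_sym (negbTE iq).
Qed.

Lemma degree_delta (M : {set edge E}) i : degree_in M i = #|M :&: delta p q [set i]|.
Proof.
rewrite /degree_in; congr #|pred_of_set _|; apply/setP => e.
by rewrite [LHS]inE in_setI in_star.
Qed.

Lemma matching_star_le1 (F : {set edge E}) :
  (forall i, #|F :&: delta p q [set i]| <= 1)%N -> is_matching F.
Proof.
move=> F1 e f eF fF ef; apply/pred0P => i /=; apply/negP => /andP[ie jf].
have := F1 i; rewrite leqNgt => /negP; apply.
have <- : #|[set e; f]| = 2%N by rewrite cards2 ef.
apply/subset_leq_card/subsetP => g; rewrite in_set2 => /orP[]/eqP->.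
  by rewrite in_setI eF in_star.
by rewrite in_setI fF in_star.
Qed.

End SimpleGraph.

Theorem theorem6 (R : realType) (V : finType) (E : {set {set V}})
    (simpleE : simple_graph E)
    (Vman Vopt : {set V})
    (coverV : Vman :|: Vopt = [set: V])
    (disjointV : [disjoint Vman & Vopt]) :
  convex_hull
    [set y : {ffun edge E -> R^o} |
      exists2 M : {set edge E}, is_2MO Vman Vopt M & y = incidence_vector R M]%classic
  = [set y : {ffun edge E -> R^o} |
      [/\ forall i, i \in Vman -> \sum_(e in cut E [set i]%SET) y e = 2,
          forall i, i \in Vopt -> \sum_(e in cut E [set i]%SET) y e <= 2,
          forall (S : {set V}) (F : {set edge E}),
            F \subset cut E S -> is_matching F -> odd #|F| ->
            1 <= \sum_(e in cut E S :\: F) y e + \sum_(e in F) (1 - y e)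
        & forall e, 0 <= y e <= 1]]%classic.
Proof.
have /choice[pq pqP] : forall e : edge E, exists z : V * V,
    z.1 != z.2 /\ val e = [set z.1; z.2].
  by move=> e; have /eqP/cards2P[a [b ab]] := simpleE _ (valP e); exists (a, b).
pose p e := (pq e).1; pose q e := (pq e).2.
have pqN e : p e != q e by have [] := pqP e.
have edgeE e : val e = [set p e; q e] by have [] := pqP e.
have manopt i : i \in Vman \/ i \in Vopt.
  by have := in_setT i; rewrite -coverV in_setU => /orP.
apply/funext => y; apply/propext; split.
  move=> [n [c [z [c0 c1 zM ->]]]].
  have /choice[M MP] : forall k, exists M : {set edge E},
      is_2MO Vman Vopt M /\ z k = incidence_vector R M.
    by move=> k; have [M] := zM k; exists M.
  have deg02 k i : degree_in (M k) i = 0%N \/ degree_in (M k) i = 2%N.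
    by have [[man opt] _] := MP k; case: (manopt i) => [/man|/opt]; auto.
  have yE e : (\sum_(k < n) c k *: z k) e = \sum_(k < n) c k * (e \in M k)%:R.
    by rewrite sum_ffunE; apply: eq_bigr => k _; rewrite (MP k).2 !ffunE.
  have ysum (D : {set edge E}) : \sum_(e in D) (\sum_(k < n) c k *: z k) e
      = \sum_(k < n) c k * #|M k :&: D|%:R.
    rewrite (eq_bigr _ (fun e _ => yE e)) exchange_big; apply: eq_bigr => k _.
    by rewrite -mulr_sumr -natr_sum setIC card_setI_sum.
  have degE k i : #|M k :&: cut E [set i]| = degree_in (M k) i.
    by rewrite (cut_delta pqN edgeE) (degree_delta pqN edgeE).
  split.
  - move=> i iman; rewrite ysum; under eq_bigr => k _.
      rewrite degE; have [[man _] _] := MP k; rewrite man //; over.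
    by rewrite -mulr_suml c1 mul1r.
  - move=> i iopt; rewrite ysum.
    apply: (@le_trans _ _ (\sum_k c k * 2)); last by rewrite -mulr_suml c1 mul1r.
    apply: ler_sum => k _; rewrite ler_wpM2l // degE.
    by case: (deg02 k i) => ->; rewrite ?lexx ?ler0n.
  (* At [M k] the left side counts the edges of [cut E S] on which [M k] and [F] differ. It is 0
     only if [M k] meets the cut exactly in [F], but a set with all degrees 0 or 2 meets every cut
     in an even number of edges. *)
  - move=> S F FS _ oF; have key k :
        1 <= #|M k :&: (cut E S :\: F)|%:R + (#|F|%:R - #|M k :&: F|%:R) :> R.
      rewrite -(cardsID (M k) F) setIC [M k :&: F]setIC natrD addrAC subrr add0r.
      rewrite -natrD ler1n lt0n addn_eq0 !cards_eq0.
      apply/negP => /andP[/eqP MF /eqP FM].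
      have MkF : M k :&: cut E S = F.
        apply/setP => e; rewrite in_setI; have := subsetP FS e.
        have := in_set0 e; rewrite -{1}FM; have := in_set0 e; rewrite -{1}MF !in_setI !in_setD.
        case: (e \in F); case: (e \in M k) => //=; first by move=> _ _ ->.
        by rewrite andbT => ->.
      move: oF; rewrite -MkF (cut_delta pqN edgeE) odd_card_cut //; apply/negP.
      elim/big_rec: _ => // i m _ /negbTE mo.
      by rewrite oddD mo -(degree_delta pqN edgeE); case: (deg02 k i) => ->.
    rewrite sumrB sumr_const !ysum -[leLHS]c1.
    have -> : 1 *+ #|F| = \sum_(k < n) c k * #|F|%:R :> R by rewrite -mulr_suml c1 mul1r.
    rewrite -sumrB -big_split; apply: ler_sum => k _ /=.
    by rewrite -mulrBr -mulrDr ler_peMr.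
  - move=> e; rewrite yE sumr_ge0 => [|k _]; last by rewrite mulr_ge0.
    rewrite -[leRHS]c1; apply: ler_sum => k _.
    by rewrite -[leRHS]mulr1 ler_wpM2l // lern1 leq_b1.
move=> [yman yopt ymat y01].
have y2 i : \sum_(e in delta p q [set i]) y e <= 2.
  by rewrite -(cut_delta pqN edgeE); case: (manopt i) => [/yman->|/yopt].
have ycost (S : {set V}) (F : {set edge E}) : F \subset delta p q S ->
    (forall i, #|F :&: delta p q [set i]| <= 1)%N -> odd #|F| ->
    1 <= blossom_cost p q y S F.
  rewrite /blossom_cost -(cut_delta pqN edgeE) => FS F1 oF.
  by apply: ymat => //; exact: matching_star_le1 F1.
have [I [c [M [c0 c1 cP cE]]]] := optional_two_matching_mixture pqN y2 y01 ycost.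
(* [convex_hull] asks every listed point to be the vector of a 2MO solution, even at weight 0, so
   the sum is reindexed over the nonzero weights. *)
pose J := [set k | c k != 0].
have big_J (f : I -> R) : (forall k, c k = 0 -> f k = 0) ->
    \sum_(k < #|J|) f (enum_val k) = \sum_k f k.
  move=> f0; rewrite -(big_enum_val f) big_mkcond; apply: eq_bigr => k _.
  by rewrite inE; case: eqVneq => //= /f0->.
exists #|J|, (fun k => c (enum_val k)), (fun k => incidence_vector R (M (enum_val k))).
split=> //.
- by rewrite big_J.
- move=> k; have := enum_valP k; rewrite inE => ck.
  exists (M (enum_val k)) => //; split=> i; rewrite (degree_delta pqN edgeE).
    move=> /yman; rewrite (cut_delta pqN edgeE) => yi.
    by case: (cP _ ck i) => // -[]; rewrite yi eqxx.
  by move=> _; case: (cP _ ck i) => [->|[_ ->]]; auto.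
- apply/ffunP => e; rewrite cE sum_ffunE -big_J => [|k ->]; last by rewrite mul0r.
  by apply: eq_bigr => k _; rewrite !ffunE.
Qed.
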